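(* Fix $0<\delta<1/2$, $\lambda>0$ and a positive integer $r$. For large $x$ let $y=(\log x)^{3r}$, $z=x^{(\log\log x)^{-3r}}$, $S=\sum_{y<p<z}1/p$ (sum over primes), and for an integer $n$ let $\omega(n;y,z)=\#\{p \text{ prime}: p\mid n,\ y<p<z\}$. Let $0\le b_1<\cdots<b_r\le\lambda(\log\log x)^{1/2-\delta}$ be integers. Let $T_1,\dots,T_r$ be real numbers with $|T_i|\le \frac{1}{1000}S^{1/2}$, and put $t_i=T_iS^{-1/2}$. Then $$\frac{1}{x}\sum_{n\le x}\prod_{i=1}^{r}\exp\Big(\mathrm{i}\,T_i\,\frac{\omega(n+b_i;y,z)-S}{\sqrt S}\Big)=\prod_{i=1}^{r}\exp\Big(\big(e^{\mathrm{i} t_i}-1-\mathrm{i} t_i\big)S\Big)+O\Big(\frac{1}{\log x}\Big),$$ where the implied constant depends only on $r,\delta,\lambda$.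
   Context: $\mathrm{i}=\sqrt{-1}$; $p$ denotes primes. *)

(* Defs.v *)
From mathcomp Require Import all_boot all_order all_algebra.
From mathcomp Require Import all_reals all_analysis.
From mathcomp Require Import complex.

Set Implicit Arguments.
Unset Strict Implicit.
Unset Printing Implicit Defensive.

Import Order.TTheory GRing.Theory Num.Theory.

Local Open Scope ring_scope.
Local Open Scope complex_scope.

Definition cexp (R : realType) (w : R[i]) : R[i] :=
  (expR (complex.Re w))%:C
    * (cos (complex.Im w) +i* sin (complex.Im w)).

Definition ycut (R : realType) (r : nat) (x : R) : R := ln x ^+ (3 * r).

Definition zcut (R : realType) (r : nat) (x : R) : R :=
  x `^ (ln (ln x) ^- (3 * r)).

(* A prime p < z satisfies p <= truncn z, so the finite range loses nothing. *)
Definition prime_recip_sum (R : realType) (y z : R) : R :=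
  \sum_(0 <= p < (Num.truncn z).+1 | prime p && (y < p%:R < z)) p%:R^-1.

(* Meaningful for n > 0 only, since primes 0 is empty. *)
Definition omega (R : realType) (n : nat) (y z : R) : nat :=
  size [seq p <- primes n | y < p%:R < z].

(* Main.v *)
Require Import Defs.
From mathcomp Require Import all_boot all_order all_algebra.
From mathcomp Require Import all_reals all_analysis.
From mathcomp Require Import complex.
From mathcomp Require Import zify ring lra.

Set Implicit Arguments.
Unset Strict Implicit.
Unset Printing Implicit Defensive.

Import Order.TTheory GRing.Theory Num.Theory.

Local Open Scope ring_scope.

(**
Put u_i = exp(i t_i) - 1 and U = sum_i u_i.  For large x the shifts b_i are
smaller than y, so a prime p in (y, z) divides at most one n + b_i, and after
removing the phases exp(-i t_i S) the summand is the product over p of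
1 + sum_i u_i [p | n + b_i], whose factors have modulus 1.  Expanding into
elementary symmetric polynomials and truncating at level K costs at most the
K-th one in the moduli, exactly as in Bonferroni's inequalities.  The truncated
expansion is averaged over n <= N by the Chinese remainder theorem, giving
N prod_p (1 + U/p) up to 2N (2rS)^K / K! + (1 + 2rz)^K, and
prod_p (1 + U/p) = exp(US) + O(S/y) because every factor on either side has
modulus at most 1.  With S = O(log log x), which needs only Chebyshev's bound
on dyadic blocks of primes, the choice K ~ (log log x)^2 makes all errors
O(1/log x).
*)

(** * Elementary symmetric polynomials and truncated product expansions *)

Fixpoint esym (F : pzSemiRingType) (k : nat) (s : seq F) {struct s} : F :=
  match k, s with
  | 0, _ => 1
  | k'.+1, [::] => 0
  | k'.+1, a :: s' => esym k s' + a * esym k' s'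
  end.

Lemma esym0 (F : pzSemiRingType) (s : seq F) : esym 0 s = 1.
Proof. by case: s. Qed.

Lemma esym_ge0 (F : numDomainType) k (s : seq F) :
  all (>= 0) s -> 0 <= esym k s.
Proof.
elim: s k => [|a s IHs] [|k] //= /andP[a0 s0].
by rewrite addr_ge0 ?mulr_ge0 ?IHs.
Qed.

Lemma sumr_all_ge0 (F : numDomainType) (s : seq F) :
  all (>= 0) s -> 0 <= \sum_(a <- s) a.
Proof. by move=> /allP s0; rewrite big_seq sumr_ge0. Qed.

Lemma ler_esym (F : numDomainType) (I : eqType) (f g : I -> F) k (s : seq I) :
  {in s, forall i, 0 <= f i <= g i} -> esym k (map f s) <= esym k (map g s).
Proof.
elim: s k => [|a s IHs] [|k] // fg /=.
have [fa fga] := andP (fg a (mem_head _ _)).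
have fgs : {in s, forall i, 0 <= f i <= g i}.
  by move=> i si; apply: fg; rewrite inE si orbT.
rewrite lerD ?IHs// ler_pM ?IHs// esym_ge0//.
by apply/allP => _ /mapP[i /fgs/andP[fi _] ->].
Qed.

(** In the expanded [k]-th power of the sum every product over [k] distinct positions occurs [k!]
    times, and all other terms are nonnegative. *)
Lemma esym_le_exp (F : numFieldType) k (s : seq F) : all (>= 0) s ->
  esym k s <= (\sum_(a <- s) a) ^+ k / k`!%:R.
Proof.
elim: s k => [|a s IHs] [|k] s0; rewrite ?esym0 ?expr0 ?fact0 ?divr1//.
  by rewrite big_nil expr0n mul0r.
move: s0 => /=/andP[a0 s0]; rewrite big_cons.
set S := \sum_(_ <- _) _; have S0 : 0 <= S by exact: sumr_all_ge0.
apply: le_trans (lerD (IHs k.+1 s0) (ler_wpM2l a0 (IHs k s0))) _.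
rewrite -/S factS natrM invfM [S ^+ k.+1 * _]mulrA [leRHS]mulrA.
have -> : a * (S ^+ k / k`!%:R) = (k.+1%:R * a * S ^+ k) / k.+1%:R / k`!%:R.
  by rewrite -[k.+1%:R * a * _]mulrA [k.+1%:R * _]mulrC mulfK ?pnatr_eq0// mulrA.
have -> : S ^+ k.+1 / k.+1%:R / k`!%:R + (k.+1%:R * a * S ^+ k) / k.+1%:R / k`!%:R =
   (S ^+ k.+1 + k.+1%:R * a * S ^+ k) / k.+1%:R / k`!%:R by ring.
do 2![apply: ler_wpM2r; first by rewrite invr_ge0].
(* What remains is [S^(k+1) + (k+1) a S^k <= (a + S)^(k+1)]: the right side is cut after two terms
   of the binomial expansion. *)
elim: (k) => [|m IHm]; first by rewrite !expr1 expr0 mulr1 mul1r addrC.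
rewrite [leRHS]exprS; apply: le_trans (ler_wpM2l (addr_ge0 a0 S0) IHm).
rewrite -subr_ge0 !exprS.
have -> : (a + S) * (S * S ^+ m + m.+1%:R * a * S ^+ m) -
  (S * (S * S ^+ m) + m.+2%:R * a * (S * S ^+ m)) = m.+1%:R * a ^+ 2 * S ^+ m.
  by rewrite -[m.+2]add1n natrD; ring.
by rewrite !mulr_ge0 ?exprn_ge0.
Qed.

(** Without the factorials the bound is a geometric sum in [S], and [(1 + S)^K] contains each [S^k]
    with coefficient at least 1. *)
Lemma sum_esym_le (F : numFieldType) K (s : seq F) : all (>= 0) s ->
  \sum_(k < K.+1) esym k s <= (1 + \sum_(a <- s) a) ^+ K.
Proof.
move=> s0; set S := \sum_(a <- s) _.
have S0 : 0 <= S by exact: sumr_all_ge0.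
have esymX k : esym k s <= S ^+ k.
  apply: le_trans (esym_le_exp k s0) _.
  by rewrite ler_pdivrMr ?ltr0n ?fact_gt0// ler_peMr ?exprn_ge0// ler1n fact_gt0.
apply: (@le_trans _ _ (\sum_(k < K.+1) S ^+ k)); first exact: ler_sum.
elim: K => [|K IH]; first by rewrite big_ord1.
rewrite big_ord_recr/= [leRHS]exprS mulrDl mul1r lerD//.
by rewrite exprS ler_wpM2l// lerXn2r ?nnegrE ?addr_ge0// lerDr.
Qed.

(* Peeling off one factor at a time, the error of truncating the expansion at
   level K is governed by level K alone since every tail product has norm <= 1. *)
Lemma bonferroni (F : numDomainType) (I : eqType) (f : I -> F) (s : seq I) K :
  {in s, forall i, `|1 + f i| <= 1} ->
  `|\prod_(i <- s) (1 + f i) - \sum_(k < K) esym k (map f s)|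
    <= esym K [seq `|f i| | i <- s].
Proof.
elim: s K => [|a s IHs] [|K] fs.
- by rewrite big_nil big_ord0 subr0 normr1.
- rewrite big_nil big_ord_recl/= big1// addr0 subrr normr0//.
- rewrite big_ord0 subr0 esym0 normr_prod big_seq prodr_ile1// => i si.
  by rewrite normr_ge0 fs.
have fs' : {in s, forall i, `|1 + f i| <= 1}.
  by move=> i si; apply: fs; rewrite inE si orbT.
rewrite big_cons.
have -> : \sum_(k < K.+1) esym k [seq f i | i <- a :: s] =
  \sum_(k < K.+1) esym k (map f s) + f a * \sum_(k < K) esym k (map f s).
  by rewrite !big_ord_recl/= !esym0 mulr_sumr -addrA -big_split.
set p := \prod_(_ <- _) _; set x := \sum_(_ < _) _; set y := \sum_(_ < _) _.
have -> : (1 + f a) * p - (x + f a * y) = (p - x) + f a * (p - y) by ring.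
apply: le_trans (ler_normD _ _) _; rewrite normrM /= lerD//.
  exact: IHs.
by rewrite ler_wpM2l// IHs.
Qed.

(** * Counting integers in a residue class *)

Lemma sum_dvdn_shift d e N : (0 < d)%N ->
  (\sum_(1 <= n < N.+1 | d %| n + e) 1 = (N + e) %/ d - e %/ d)%N.
Proof.
move=> d0; rewrite big_mkcond; elim: N => [|N IH].
  by rewrite big_geq// subnn.
have le_e : (e %/ d <= (N + e) %/ d)%N by rewrite leq_div2r// leq_addl.
by rewrite big_nat_recr//= IH addSn divnS//; case: (d %| _)%N; lia.
Qed.

(** The count is a difference of two floors whose arguments differ by [N / d], so the error is a
    difference of two fractional parts. *)
Lemma density_dvdn_shift (F : numFieldType) d e N : (0 < d)%N ->
  `|\sum_(1 <= n < N.+1 | (d %| n + e)%N) 1 - N%:R / d%:R| <= 1 :> F.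
Proof.
move=> d0.
have -> : \sum_(1 <= n < N.+1 | (d %| n + e)%N) 1 = ((N + e) %/ d - e %/ d)%:R :> F.
  by rewrite -sum_dvdn_shift// natr_sum.
set c := (_ - _)%N.
have d0' : 0 < d%:R :> F by rewrite ltr0n.
have -> : c%:R - N%:R / d%:R = ((c * d)%:R - N%:R) / d%:R :> F.
  by rewrite natrM; field; rewrite gt_eqF.
have [] : (c * d <= N + d)%N /\ (N <= c * d + d)%N.
  have := divn_eq (N + e) d; have := divn_eq e d.
  have := ltn_pmod (N + e) d0; have := ltn_pmod e d0.
  rewrite /c mulnBl; lia.
move=> c1 c2; rewrite normrM normfV [`|d%:R|]gtr0_norm// ler_pdivrMr// mul1r.
case: (leqP (c * d) N) => h.
  by rewrite distrC -(natrB _ h) ger0_norm// ler_nat leq_subLR.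
by rewrite -(natrB _ (ltnW h)) ger0_norm// ler_nat leq_subLR.
Qed.

(** * Mean values over [n <= N] by the Chinese remainder theorem *)

Section mean_value.
Variables (F : numFieldType) (r : nat) (b : 'I_r -> nat).
Implicit Types (u : 'I_r -> F) (P : seq nat).

(** When [p] divides at most one [n + b i], this is that [u i], or 0. The form as a sum keeps it
    linear in [u], so averages can be taken one [i] at a time. *)
Definition hit u (n p : nat) : F := \sum_(i < r | (p %| n + b i)%N) u i.

(** The side condition [d %| n + e] carries the induction on [P]. Choosing [p] in a product imposes
    [p %| n + b i] for some [i], which merges with the side condition into one modulo [d * p]. Every
    fully expanded term ends as a count with error at most 1, so the errors add up to the same
    polynomial in the moduli of the [u i]. *)
Lemma mean_esym u P k d e N : uniq P -> all prime P -> (0 < d)%N ->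
  all (coprime d) P ->
  `|\sum_(1 <= n < N.+1 | (d %| n + e)%N) esym k (map (hit u n) P)
     - N%:R / d%:R * esym k [seq (\sum_i u i) / p%:R | p <- P]|
  <= esym k [seq \sum_i `|u i| | _ <- P].
Proof.
elim: P k d e => [|p P IHP] [|k] d e uP pP d0 dP.
- by rewrite /= mulr1 density_dvdn_shift.
- by rewrite /= big1 ?mulr0 ?subrr ?normr0.
- by rewrite !esym0 mulr1; under eq_bigr do rewrite esym0; exact: density_dvdn_shift.
move: uP pP dP => /= /andP[pnP uP] /andP[pp pP] /andP[dp dP].
rewrite big_split/=.
have p0 := prime_gt0 pp.
(* This shift is [e] modulo [d] and [b i] modulo [p]. *)
pose e' i := chinese d p e (b i).
have -> : \sum_(1 <= n < N.+1 | (d %| n + e)%N) hit u n p * esym k (map (hit u n) P)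
  = \sum_i u i * \sum_(1 <= n < N.+1 | (d * p %| n + e' i)%N) esym k (map (hit u n) P).
  under eq_bigr do rewrite /hit mulr_suml.
  rewrite (exchange_big_dep predT)//=; apply: eq_bigr => i _.
  rewrite mulr_sumr; apply: eq_bigl => n.
  rewrite Gauss_dvd//; congr andb.
    rewrite /dvdn -modnDmr -(chinese_modl dp e (b i)) modnDmr//.
  by rewrite /dvdn -modnDmr -(chinese_modr dp e (b i)) modnDmr.
set X := \sum_(_ <= _ < _ | _) _; set A := esym k.+1 _.
set B := esym k [seq _ | _ <- _].
set Y := fun i => \sum_(1 <= n < N.+1 | (d * p %| n + e' i)%N) esym k (map (hit u n) P).
have -> : X + \sum_i u i * Y i - N%:R / d%:R * (A + (\sum_i u i) / p%:R * B) =
  (X - N%:R / d%:R * A) + \sum_i u i * (Y i - N%:R / (d * p)%:R * B).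
  under [in RHS]eq_bigr do rewrite mulrBr.
  rewrite sumrB -mulr_suml natrM invfM; ring.
apply: le_trans (ler_normD _ _) _; apply: lerD.
  exact: IHP.
rewrite mulr_suml; apply: le_trans (ler_norm_sum _ _ _) _.
apply: ler_sum => i _; rewrite normrM ler_wpM2l//.
apply: IHP; rewrite ?muln_gt0 ?d0//.
apply/allP => q qP; rewrite coprimeMl (allP dP)//=.
rewrite prime_coprime// dvdn_prime2 ?(allP pP q)//.
by apply: contra pnP => /eqP ->.
Qed.

Lemma mean_esym1 u P k N : uniq P -> all prime P ->
  `|\sum_(1 <= n < N.+1) esym k (map (hit u n) P)
     - N%:R * esym k [seq (\sum_i u i) / p%:R | p <- P]|
  <= esym k [seq \sum_i `|u i| | _ <- P].
Proof.
move=> uP pP; have := @mean_esym u P k 1 0 N uP pP isT.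
rewrite divr1; under eq_bigl do rewrite dvd1n.
by apply; apply/allP => p _; rewrite coprime1n.
Qed.

(** The factor is an average over [p] residue classes, with value [1 + u i] on [r] of them and 1 on
    the remaining [p - r], hence a convex combination of numbers in the unit disc. *)
Lemma norm_mean_factor u p : (0 < p)%N -> (r <= p)%N ->
  (forall i, `|1 + u i| <= 1) -> `|1 + (\sum_i u i) / p%:R| <= 1.
Proof.
move=> p_gt0 rp u1; have p0 : 0 < p%:R :> F by rewrite ltr0n.
have -> : 1 + (\sum_i u i) / p%:R = (\sum_i (1 + u i) + (p - r)%:R) / p%:R.
  rewrite big_split/= sumr_const card_ord natrB//.
  by rewrite addrACA addrC subrKA addrC mulrDl divff ?gt_eqF// addrC.
rewrite normrM normfV [`|p%:R|]gtr0_norm// ler_pdivrMr// mul1r.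
apply: le_trans (ler_normD _ _) _; rewrite normr_nat.
apply: (@le_trans _ _ (r%:R + (p - r)%:R)).
  rewrite lerD2r; apply: le_trans (ler_norm_sum _ _ _) _.
  by rewrite -[r in r%:R]card_ord -sumr_const ler_sum.
by rewrite -natrD subnKC.
Qed.

(** The doubled term comes from truncating twice, once for each [n] and once in the Euler product.
    The last term collects the counting errors of all levels up to [K]. *)
Lemma mean_multiplicative u P K N (V : F) :
  uniq P -> all prime P -> all (geq^~ r) P ->
  {in P, forall p n i j, (p %| n + b i)%N -> (p %| n + b j)%N -> i = j} ->
  (forall i, `|1 + u i| <= 1) -> \sum_i `|u i| <= V ->
  `|\sum_(1 <= n < N.+1) \prod_(p <- P) (1 + hit u n p)
     - N%:R * \prod_(p <- P) (1 + (\sum_i u i) / p%:R)|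
  <= (N%:R * ((V * \sum_(p <- P) p%:R^-1) ^+ K / K`!%:R)) *+ 2
     + (1 + V * (size P)%:R) ^+ K.
Proof.
move=> uP pP rP dj u1 uV.
set U := \sum_i u i; set VV := \sum_i `|u i| in uV *.
have VV0 : 0 <= VV by exact: sumr_ge0.
have r0 p : p \in P -> (0 < p)%N by move=> /(allP pP)/prime_gt0.
have hitE n p : p \in P -> (hit u n p = 0) \/ (exists i, hit u n p = u i).
  move=> pinP; case: (pickP (fun i => p %| n + b i)%N) => [i ip|no].
    right; exists i; rewrite /hit (bigD1 i)//= big1 ?addr0// => j /andP[jp].
    by rewrite (dj p pinP n i j)// eqxx.
  by left; rewrite /hit big_pred0.
have hit1 n : {in P, forall p, `|1 + hit u n p| <= 1}.
  by move=> p /(hitE n)[->|[i ->]]; rewrite ?addr0 ?normr1.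
have U1 : {in P, forall p : nat, `|1 + U / p%:R| <= 1}.
  by move=> p pP'; rewrite norm_mean_factor ?r0//; exact: (allP rP).
set E := _ ^+ K / _.
(* The truncation error is again an elementary symmetric polynomial, now in the moduli, so the same
   averaging applies with [|u i|] in place of [u i]. *)
have hitK : \sum_(1 <= n < N.+1) esym K [seq `|hit u n p| | p <- P]
    <= N%:R * E + esym K [seq VV | _ <- P].
  pose v i := `|u i|.
  have : \sum_(1 <= n < N.+1) esym K [seq `|hit u n p| | p <- P]
      <= \sum_(1 <= n < N.+1) esym K (map (hit v n) P).
    apply: ler_sum => n _; apply: ler_esym => p _.
    by rewrite normr_ge0 ler_norm_sum.
  move=> /le_trans; apply.
  have := mean_esym1 v K N uP pP.
  have -> : \sum_i `|v i| = VV by apply: eq_bigr => i _; rewrite normr_id.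
  rewrite -/VV; set A := \sum_(_ <= _ < _) _; set B := N%:R * _ => h.
  have A0 : 0 <= A.
    rewrite sumr_ge0// => n _; rewrite esym_ge0//.
    by apply/allP => _ /mapP[p _ ->]; rewrite sumr_ge0// => i _; exact: normr_ge0.
  have V0 : all (>= 0) [seq VV / p%:R | p <- P].
    by apply/allP => _ /mapP[p _ ->]; rewrite divr_ge0.
  have B0 : 0 <= B by rewrite mulr_ge0// esym_ge0.
  rewrite -(ger0_norm A0) -(subrK B A) addrC; apply: le_trans (ler_normD _ _) _.
  apply: lerD => //; rewrite ger0_norm// ler_wpM2l//.
  apply: le_trans (esym_le_exp _ V0) _.
  have S0 : 0 <= \sum_(p <- P) p%:R^-1 :> F.
    by rewrite sumr_ge0// => i _; rewrite invr_ge0.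
  rewrite /E big_map -mulr_sumr ler_wpM2r ?invr_ge0// lerXn2r ?nnegrE ?mulr_ge0//.
    exact: le_trans uV.
  by rewrite ler_wpM2r.
have main : N%:R * `|\prod_(p <- P) (1 + U / p%:R) -
     \sum_(k < K) esym k [seq U / p%:R | p <- P]| <= N%:R * E.
  rewrite ler_wpM2l//; apply: le_trans (bonferroni K U1) _.
  apply: (@le_trans _ _ (esym K [seq V / p%:R | p <- P])).
    apply: ler_esym => p pinP; rewrite normr_ge0 normrM normfV normr_nat.
    by rewrite ler_wpM2r ?invr_ge0// (le_trans _ uV)// ler_norm_sum.
  apply: le_trans (esym_le_exp _ _) _; last by rewrite big_map -mulr_sumr.
  by apply/allP => _ /mapP[p _ ->]; rewrite divr_ge0// (le_trans VV0).
have mid : `|\sum_(1 <= n < N.+1) \sum_(k < K) esym k (map (hit u n) P) -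
    N%:R * \sum_(k < K) esym k [seq U / p%:R | p <- P]|
    <= \sum_(k < K) esym k [seq VV | _ <- P].
  rewrite exchange_big mulr_sumr -sumrB; apply: le_trans (ler_norm_sum _ _ _) _.
  by apply: ler_sum => k _; exact: mean_esym1.
have fst : `|\sum_(1 <= n < N.+1) \prod_(p <- P) (1 + hit u n p) -
    \sum_(1 <= n < N.+1) \sum_(k < K) esym k (map (hit u n) P)|
    <= N%:R * E + esym K [seq VV | _ <- P].
  apply: le_trans hitK; rewrite -sumrB; apply: le_trans (ler_norm_sum _ _ _) _.
  by apply: ler_sum => n _; apply: bonferroni; exact: hit1.
have := sum_esym_le K (s := [seq VV | _ <- P]).
rewrite big_map big_const_seq count_predT iter_addr_0 -[VV *+ _]mulr_natr => Kle.
have {}Kle : \sum_(k < K.+1) esym k [seq VV | _ <- P] <= (1 + V * (size P)%:R) ^+ K.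
  apply: le_trans (Kle _) _; first by apply/allP => _ /mapP[p _ ->].
  have V0 : 0 <= V := le_trans VV0 uV.
  rewrite lerXn2r ?nnegrE ?addr_ge0 ?mulr_ge0//.
  by rewrite lerD2l ler_wpM2r.
(* The levels below [K] come from [mid] and level [K] from [fst]; together they are the sum bounded
   in [Kle]. *)
rewrite big_ord_recr/= in Kle.
apply: le_trans (lerD (lexx _) Kle).
have {}main : `|N%:R * \sum_(k < K) esym k [seq U / p%:R | p <- P] -
    N%:R * \prod_(p <- P) (1 + U / p%:R)| <= N%:R * E.
  by rewrite -mulrBr normrM normr_nat distrC.
pose trunc := \sum_(1 <= n < N.+1) \sum_(k < K) esym k (map (hit u n) P).
apply: le_trans (ler_distD trunc _ _) _.
pose euler := N%:R * \sum_(k < K) esym k [seq U / p%:R | p <- P].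
apply: le_trans (lerD fst (ler_distD euler _ _)) _.
apply: le_trans (lerD (lexx _) (lerD mid main)) _.
by rewrite mulr2n le_eqVlt; apply/orP; left; apply/eqP; ring.
Qed.
End mean_value.

(** * Chebyshev's bound on dyadic blocks and sums of prime reciprocals *)

Lemma leq_bin_exp2 n m : ('C(n, m) <= 2 ^ n)%N.
Proof.
case: (ltnP n m) => [h|h]; first by rewrite bin_small.
rewrite -[2%N]/(1 + 1)%N expnDn -ltnS in h *.
rewrite (bigD1 (Ordinal h))//= !exp1n !muln1; exact: leq_addr.
Qed.

Lemma prod_primes_dvdn (s : seq nat) m : uniq s -> all prime s ->
  all (dvdn^~ m) s -> (\prod_(p <- s) p %| m)%N.
Proof.
elim: s => [|p s IH] /=; first by rewrite big_nil dvd1n.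
move=> /andP[ps us] /andP[pp sp] /andP[pm sm].
rewrite big_cons Gauss_dvd ?pm ?IH//.
rewrite big_seq; apply: (big_ind (coprime p)); rewrite ?coprimen1//.
  by move=> a b pa pb; rewrite coprimeMr pa.
move=> q qs; rewrite prime_coprime// dvdn_prime2 ?(allP sp q)//.
by apply: contra ps => /eqP ->.
Qed.

Definition dyadic_primes k := [seq p <- index_iota (2 ^ k).+1 (2 ^ k.+1).+1 | prime p].

(** With [n = 2^k], each prime in [(n, 2n]] divides [(2n)!] but not [n!], hence divides the central
    binomial coefficient, which is at most [2^(2n)]. Each such prime also exceeds [2^k]. *)
Lemma size_dyadic_primes k : (k * size (dyadic_primes k) <= 2 ^ k.+1)%N.
Proof.
rewrite -(@leq_exp2l 2)// expnM.
have bin0 : (0 < 'C(2 ^ k.+1, 2 ^ k))%N by rewrite bin_gt0 leq_exp2l.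
apply: (@leq_trans (\prod_(p <- dyadic_primes k) p)).
  rewrite -[X in (_ ^ X)%N]count_predT -sum1_count expn_sum.
  rewrite !big_seq leq_prod// => p.
  by rewrite mem_filter mem_index_iota expn1 => /and3P[_ /ltnW].
apply: leq_trans (leq_bin_exp2 _ (2 ^ k)); apply: dvdn_leq => //.
apply: prod_primes_dvdn.
- by rewrite filter_uniq// iota_uniq.
- exact: filter_all.
apply/allP => p; rewrite mem_filter mem_index_iota => /and3P[pp pl pu].
have : (p %| (2 ^ k.+1)`!)%N by rewrite dvdn_fact// prime_gt0.
have e : (2 ^ k.+1 - 2 ^ k = 2 ^ k)%N by rewrite expnS mul2n -addnn addnK.
rewrite -(@bin_fact _ (2 ^ k)) ?leq_exp2l// e !Euclid_dvdM//.
have nd : ~~ (p %| (2 ^ k)`!)%N.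
  move: (2 ^ k)%N pl => n; elim: n => [|n IH].
    by rewrite dvdn1 => _; rewrite gtn_eqF ?prime_gt1.
  move=> np; rewrite factS Euclid_dvdM// negb_or IH ?(ltn_trans _ np)// andbT.
  by rewrite gtnNdvd.
by rewrite (negbTE nd) !orbF.
Qed.

Section real.
Variable R : realType.

Lemma harmonic_le_ln n : \sum_(1 <= k < n.+2) k%:R^-1 <= 1 + ln n.+1%:R :> R.
Proof.
elim: n => [|n IH]; first by rewrite big_nat1 ln1 addr0 invr1.
rewrite big_nat_recr//=; apply: le_trans (lerD IH (lexx _)) _.
rewrite -addrA lerD2l.
have n0 : 0 < n.+1%:R :> R by []. have n1 : 0 < n.+2%:R :> R by [].
rewrite -lerBrDl -[leRHS]opprB -ln_div ?posrE// lerNr.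
have -> : n.+1%:R / n.+2%:R = 1 + - n.+2%:R^-1 :> R.
  have -> : n.+1%:R = n.+2%:R - 1 :> R by rewrite -(natr1 n.+1) addrK.
  by rewrite mulrBl divff ?gt_eqF// mul1r.
by rewrite le_ln1Dx// ltrN2 invf_lt1// ltr1n.
Qed.

Lemma sum_prime_recip_dyadic k :
  \sum_(p <- dyadic_primes k.+1) p%:R^-1 <= 2 / k.+1%:R :> R.
Proof.
have := size_dyadic_primes k.+1; set s := dyadic_primes _ => h.
apply: (@le_trans _ _ (\sum_(p <- s) (2 ^ k.+1)%:R^-1)).
  rewrite big_seq [leRHS]big_seq ler_sum// => p.
  rewrite mem_filter mem_index_iota => /and3P[_ pl _].
  by rewrite lef_pV2 ?posrE ?ltr0n ?expn_gt0 ?(leq_trans _ pl)// ler_nat ltnW.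
rewrite big_const_seq count_predT iter_addr_0 -[leLHS]mulr_natl.
rewrite ler_pdivrMr ?ltr0n ?expn_gt0// mulrAC ler_pdivlMr//.
by rewrite -!natrM ler_nat mulnC -expnS.
Qed.

(** The prime 2 contributes less than 1 and the block of index [k] at most [2 / k], which leaves
    twice a harmonic sum. *)
Lemma sum_prime_recip_le n :
  \sum_(0 <= p < (2 ^ n.+1).+1 | prime p) p%:R^-1 <= 3 + 2 * ln n.+1%:R :> R.
Proof.
apply: (@le_trans _ _ (1 + 2 * \sum_(1 <= k < n.+1) k%:R^-1)); last first.
  have := harmonic_le_ln n; rewrite big_nat_recr//= => h.
  have v0 : 0 <= n.+1%:R^-1 :> R by rewrite invr_ge0.
  move: h v0; move: (\sum_(1 <= k < n.+1) _) (ln _) (_^-1) => a l v.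
  lra.
elim: n => [|n IH].
  rewrite [in leRHS]big_geq// mulr0 addr0 expn1 big_mkcond /= unlock /=; lra.
rewrite (@big_cat_nat _ _ _ (2 ^ n.+1).+1) ?ltnS ?leq_exp2l//=.
rewrite [in leRHS]big_nat_recr//= mulrDr addrA lerD// -big_filter.
exact: sum_prime_recip_dyadic.
Qed.
End real.

(** * The complex exponential near 0, and comparison of products in the unit disc *)

Local Open Scope complex_scope.

Section cexp.
Import numFieldNormedType.Exports.
Variable R : realType.
Implicit Types w v : R[i].

Lemma cexpD w v : cexp (w + v) = cexp w * cexp v.
Proof.
case: w v => [a c] [d e]; rewrite /cexp/= expRD cosD sinD.
apply/eqP; rewrite eq_complex/=; apply/andP; split; apply/eqP; ring.
Qed.

Lemma cexp0 : cexp 0 = 1 :> R[i].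
Proof. by rewrite /cexp/= expR0 cos0 sin0 mul1r. Qed.

Lemma cexp_sum (I : Type) (s : seq I) (f : I -> R[i]) :
  cexp (\sum_(i <- s) f i) = \prod_(i <- s) cexp (f i).
Proof. exact: (big_morph _ cexpD cexp0). Qed.

Lemma cexpMn w n : cexp (w *+ n) = cexp w ^+ n.
Proof. by elim: n => [|n IH]; rewrite ?cexp0// mulrS cexpD IH exprS. Qed.

Lemma normC_cexp w : `|cexp w| = (expR (complex.Re w))%:C.
Proof.
rewrite /cexp normrM [X in X * _]ger0_norm ?lecR ?expR_ge0//.
by rewrite [X in _ * X]normc_def/= cos2Dsin2 sqrtr1 mulr1.
Qed.

Lemma cexp_im t : cexp ('i * t%:C) = cos t +i* sin t :> R[i].
Proof. by rewrite /cexp/= !(mul0r, mulr0, mul1r, subr0, add0r, oppr0, expR0). Qed.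

Lemma norm_cexp_im t : `|cexp ('i * t%:C)| = 1 :> R[i].
Proof. by rewrite normC_cexp/= !(mul0r, mulr0, mul1r, subr0, expR0). Qed.

Lemma abs_sin_le (x : R) : `|sin x| <= `|x|.
Proof.
wlog x0 : x / 0 <= x => [h|].
  have [/h//|/ltW x0] := leP 0 x.
  by rewrite -[X in `|sin X|]opprK sinN normrN -[leRHS]normrN h// oppr_ge0.
move: x0; rewrite le_eqVlt => /predU1P[<-|x0]; first by rewrite sin0.
have dsin y : y \in `]0, x[ -> is_derive y 1 (@sin R) (cos y).
  by move=> _; exact: is_derive_sin.
have [|c _] := @MVT _ (@sin R) (@cos R) 0 x x0 dsin.
  by apply: continuous_subspaceT; exact: continuous_sin.
rewrite sin0 !subr0 => ->; rewrite normrM ler_piMl//; exact: cos_max.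
Qed.

Lemma one_sub_cos_le (x : R) : 1 - cos x <= x ^+ 2 / 2.
Proof.
have -> : 1 - cos x = 2 * sin (x / 2) ^+ 2.
  have {1}-> : x = (x / 2) *+ 2 by rewrite mulr2n; lra.
  by rewrite cos_mulr2n sin2cos2; ring.
have h : sin (x / 2) ^+ 2 <= (x / 2) ^+ 2.
  rewrite -[leLHS]real_normK ?num_real// -[leRHS]real_normK ?num_real//.
  by rewrite lerXn2r ?nnegrE// abs_sin_le.
have -> : x ^+ 2 / 2 = 2 * (x / 2) ^+ 2 by field.
by rewrite ler_wpM2l.
Qed.

Lemma sin_sub_le (x : R) : `|x| <= 1 -> `|sin x - x| <= x ^+ 2 / 2.
Proof.
wlog x0 : x / 0 <= x => [h|].
  have [/h//|/ltW x0] := leP 0 x => x1.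
  have := h (- x); rewrite oppr_ge0 normrN sinN sqrrN => /(_ x0 x1).
  by rewrite -opprD normrN.
move=> x1; move: x0; rewrite le_eqVlt => /predU1P[<-|x0].
  by rewrite sin0 subr0 normr0 expr0n mul0r.
have dsin y : y \in `]0, x[ -> is_derive y 1 (fun y : R => sin y - y) (cos y - 1).
  by move=> _; apply: is_deriveB.
have [|c cx] := @MVT _ (fun y : R => sin y - y) (fun y => cos y - 1) 0 x x0 dsin.
  apply: continuous_subspaceT => y; apply: cvgB; [exact: continuous_sin|exact: cvg_id].
rewrite sin0 !subr0 => ->.
move: cx; rewrite in_itv/= => /andP[c0 cx].
have := one_sub_cos_le c; have := cos_le1 c => cle cge.
rewrite gtr0_norm// in x1.
rewrite normrM [`|x|]gtr0_norm// ler0_norm ?subr_le0// opprB.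
(* Here [(1 - cos c) x <= c^2 x / 2 <= x^2 / 2], because [0 < c < x <= 1]. *)
nra.
Qed.

(** From [exp(-x) >= 1 - x] one gets [exp x <= 1 / (1 - x)], so the upper bound is [x^2 / (1 - x)],
    at most [x^2] for [x <= 0]. *)
Lemma expR_sub1_le (x : R) : x <= 0 -> 0 <= expR x - 1 - x <= x ^+ 2.
Proof.
move=> x0; have := expR_ge1Dx x; have := expR_ge1Dx (- x); rewrite expRN => h1 h2.
have e0 := expR_gt0 x.
have : expR x * (1 - x) <= 1 by rewrite -ler_pdivlMl// mulr1.
nra.
Qed.

Lemma normC_le_re_im (w : R[i]) : `|w| <= (`|complex.Re w| + `|complex.Im w|)%:C.
Proof.
case: w => a c /=; rewrite normc_def/= lecR.
have -> : `|a| + `|c| = Num.sqrt ((`|a| + `|c|) ^+ 2).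
  by rewrite sqrtr_sqr [RHS]ger0_norm ?addr_ge0.
rewrite ler_wsqrtr// sqrrD !real_normK ?num_real// addrAC lerDl.
by rewrite mulrn_wge0// mulr_ge0.
Qed.

Lemma cexp_sub1_le w : complex.Re w <= 0 -> `|w| <= 1 ->
  `|cexp w - 1 - w| <= 2 * `|w| ^+ 2.
Proof.
case: w => a c /= a0 w1.
have w2 : `|a +i* c| ^+ 2 = (a ^+ 2 + c ^+ 2)%:C.
  by rewrite normc_def/= -rmorphXn sqr_sqrtr// addr_ge0 ?sqr_ge0.
have ac1 : a ^+ 2 + c ^+ 2 <= 1.
  by rewrite -lecR -w2 exprn_ile1.
rewrite w2.
have a2 := sqr_ge0 a; have c2 := sqr_ge0 c.
have c1 : `|c| <= 1.
  by rewrite -(@ler_pXn2r _ 2)// ?nnegrE// expr1n real_normK ?num_real//; lra.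
apply: le_trans (normC_le_re_im _) _.
rewrite -(rmorph_nat (real_complex R) 2) -rmorphM lecR /cexp/=.
rewrite !(mul0r, subr0, addr0, oppr0).
have e0 := expR_gt0 a; have e1 : expR a <= 1 by rewrite expR_le1.
have /andP[h1 h2] := expR_sub1_le a0.
have h3 := one_sub_cos_le c; have := cos_le1 c => h4.
have := sin_sub_le c1; rewrite ler_norml => /andP[h5 h6].
(* The quantity is [(e^a - 1 - a) - e^a (1 - cos c)], with the two parts in [[0, a^2]] and
   [[0, c^2 / 2]]. *)
have re : `|expR a * cos c - 1 - a| <= a ^+ 2 + c ^+ 2 / 2.
  rewrite ler_norml; apply/andP; split; nra.
have im : `|expR a * sin c - c| <= c ^+ 2 / 2 + (a ^+ 2 + c ^+ 2) / 2.
  rewrite (_ : expR a * sin c - c = expR a * (sin c - c) + (expR a - 1) * c);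
    last by ring.
  apply: le_trans (ler_normD _ _) _; rewrite !normrM; apply: lerD.
    rewrite gtr0_norm//; apply: le_trans (sin_sub_le c1).
    by rewrite ler_piMl.
  rewrite ler0_norm ?subr_le0// opprB.
  have : (1 - expR a) * `|c| <= - a * `|c| by rewrite ler_wpM2r//; lra.
  move/le_trans; apply.
  (* Arithmetic-geometric mean: [- a |c| <= (a^2 + c^2) / 2]. *)
  have := sqr_ge0 (a + `|c|); rewrite sqrrD real_normK ?num_real//; lra.
(* The two bounds add up to [3/2 (a^2 + c^2)]. *)
apply: le_trans (lerD re im) _; lra.
Qed.
End cexp.

(** Telescoping: factors are exchanged one at a time while the others have norm at most 1. *)
Lemma norm_prod_sub_le (F : numDomainType) (I : eqType) (s : seq I) (f g : I -> F) :
  {in s, forall i, `|f i| <= 1} -> {in s, forall i, `|g i| <= 1} ->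
  `|\prod_(i <- s) f i - \prod_(i <- s) g i| <= \sum_(i <- s) `|f i - g i|.
Proof.
elim: s => [|a s IH] f1 g1; first by rewrite !big_nil subrr normr0.
have f1' : {in s, forall i, `|f i| <= 1} by move=> i si; apply: f1; rewrite inE si orbT.
have g1' : {in s, forall i, `|g i| <= 1} by move=> i si; apply: g1; rewrite inE si orbT.
rewrite !big_cons; set p := \prod_(_ <- _) _; set q := \prod_(_ <- _) _.
have -> : f a * p - g a * q = (f a - g a) * p + g a * (p - q) by ring.
apply: le_trans (ler_normD _ _) _; rewrite !normrM lerD//.
  rewrite ler_piMr// normr_prod big_seq prodr_ile1// => i si.
  by rewrite normr_ge0 f1'.
by apply: le_trans (IH f1' g1'); rewrite ler_piMl// g1// mem_head.
Qed.

(** * The primes between [y] and [z] *)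

Section sifted.
Variables (R : realType) (y z : R).

Definition sift_primes :=
  [seq p <- index_iota 0 (Num.truncn z).+1 | prime p && (y < p%:R < z)].

Lemma sift_primes_uniq : uniq sift_primes.
Proof. by rewrite filter_uniq// iota_uniq. Qed.

Lemma mem_sift_primes p : (p \in sift_primes) = prime p && (y < p%:R < z).
Proof.
rewrite mem_filter mem_index_iota/= andb_idr// => /and3P[_ _ pz].
rewrite ltnS truncn_ge_nat ?(ltW pz)// (le_trans _ (ltW pz))//.
Qed.

Lemma sift_primes_prime : all prime sift_primes.
Proof. by apply/allP => p; rewrite mem_sift_primes => /andP[]. Qed.

Lemma size_sift_primes : 0 <= z -> (size sift_primes)%:R <= z.
Proof.
move=> z0; apply: le_trans (_ : (Num.truncn z)%:R <= z); last by rewrite truncn_le.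
rewrite ler_nat -(size_iota 1 (Num.truncn z)) uniq_leq_size// ?sift_primes_uniq//.
move=> p; rewrite mem_filter mem_index_iota mem_iota add1n /= => /andP[/andP[pp _] ->].
by rewrite andbT prime_gt0.
Qed.

Lemma prime_recip_sumE : prime_recip_sum y z = \sum_(p <- sift_primes) p%:R^-1.
Proof. by rewrite big_filter. Qed.

Lemma prime_recip_sum_ge0 : 0 <= prime_recip_sum y z.
Proof. by rewrite prime_recip_sumE sumr_ge0// => p _; rewrite invr_ge0. Qed.

Lemma omegaE n : (0 < n)%N -> omega n y z = count (dvdn^~ n) sift_primes.
Proof.
move=> n0; rewrite /omega -size_filter; apply: perm_size; apply: uniq_perm.
- by rewrite filter_uniq// primes_uniq.
- by rewrite filter_uniq// sift_primes_uniq.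
move=> p; rewrite mem_filter [RHS]mem_filter mem_sift_primes mem_primes n0/=.
by case: (prime p); case: (p %| n)%N; case: (y < _); case: (_ < z).
Qed.
End sifted.

(** * The characteristic function for fixed [y] and [z], with explicit errors *)

Section char_mean.
Variables (R : realType) (r : nat) (b : 'I_r -> nat) (y z : R).
Hypothesis b_inc : forall i j : 'I_r, (i < j)%N -> (b i < b j)%N.
Hypothesis b_lt : forall i, (b i)%:R < y.
Local Notation P := (sift_primes y z).
Local Notation S := (prime_recip_sum y z).

(** A common prime would divide a difference of two shifts, which is positive and below [y < p]. *)
Lemma sift_primes_disjoint :
  {in P, forall p n i j, (p %| n + b i)%N -> (p %| n + b j)%N -> i = j}.
Proof.
move=> p; rewrite mem_sift_primes => /and3P[_ yp _] n.
have aux (i j : 'I_r) : (i < j)%N -> (p %| n + b i)%N -> (p %| n + b j)%N -> False.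
  move=> /b_inc ij pi pj; have := dvdn_sub pj pi.
  rewrite subnDl gtnNdvd// ?subn_gt0//.
  by rewrite (leq_ltn_trans (leq_subr _ _))// -(ltr_nat R) (lt_trans (b_lt _)).
move=> i j pi pj; apply/val_inj; case: (ltngtP i j) => // h.
  by case: (aux _ _ h pi pj).
by case: (aux _ _ h pj pi).
Qed.

(** Each power is a product over the primes dividing [n + b i]. After exchanging the products, at
    most one [i] contributes at each prime. *)
Lemma prod_expn_omega (w : 'I_r -> R[i]) n : (0 < n)%N ->
  \prod_i (w i) ^+ omega (n + b i) y z =
  \prod_(p <- P) (1 + hit b (fun i => w i - 1) n p).
Proof.
move=> n0.
transitivity (\prod_i \prod_(p <- P) (if (p %| n + b i)%N then w i else 1)).
  apply: eq_bigr => i _; rewrite omegaE ?addn_gt0 ?n0// -big_mkcond.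
  by rewrite big_const_seq iter_mulr_1.
rewrite exchange_big/= big_seq [RHS]big_seq; apply: eq_bigr => p pP.
case: (pickP (fun i => p %| n + b i)%N) => [i ip|no].
  have only j : j != i -> (p %| n + b j)%N = false.
    by move=> ji; apply/negP => jp; rewrite (sift_primes_disjoint pP jp ip) eqxx in ji.
  rewrite (bigD1 i)//= ip big1 => [|j /only ->//].
  rewrite /hit (bigD1 i)//= big1 => [|j /andP[jp /only]]; last by rewrite jp.
  by rewrite mulr1 addr0 subrKC.
by rewrite [hit _ _ _ _]big_pred0// addr0 big1// => i _; rewrite no.
Qed.

Variable t : 'I_r -> R.
Let u i : R[i] := cexp ('i * (t i)%:C) - 1.

Lemma norm_charfactor i : `|u i| <= 2.
Proof. by apply: le_trans (ler_normB _ _) _; rewrite norm_cexp_im normr1. Qed.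

(** The exponential is the product of the [exp(U / p)], of modulus at most 1 since [Re U <= 0]. As
    [|U| <= 2r], factors at [p] differ by at most [2 |U / p|^2 <= 8 r^2 / p^2 <= 8 r^2 / (y p)], and
    summing over [p] gives [S]. *)
Lemma prod_euler_cexp : 0 < y -> (2 * r)%:R <= y ->
  `|\prod_(p <- P) (1 + (\sum_i u i) / p%:R) - cexp ((\sum_i u i) * S%:C)|
   <= (8 * r%:R ^+ 2 * S / y)%:C.
Proof.
move=> y0 ry.
have rP p : p \in P -> ((2 * r)%:R <= p%:R :> R) /\ y < p%:R.
  by rewrite mem_sift_primes => /and3P[_ yp _]; rewrite yp (ltW (le_lt_trans ry yp)).
rewrite prime_recip_sumE rmorph_sum mulr_sumr cexp_sum.
set U := \sum_i u i.
have U2 : `|U| <= (2 * r)%:R.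
  apply: le_trans (ler_norm_sum _ _ _) _.
  apply: (@le_trans _ _ (\sum_(i < r) 2)).
    by apply: ler_sum => i _; exact: norm_charfactor.
  by rewrite sumr_const card_ord natrM -[leLHS]mulr_natr.
have reU : complex.Re U <= 0.
  rewrite /U raddf_sum sumr_le0// => i _.
  have e : complex.Re (u i) = cos (t i) - 1 by rewrite /u cexp_im.
  by apply: (@le_trans _ _ (cos (t i) - 1)); [rewrite -e | rewrite subr_le0 cos_le1].
have U1 : {in P, forall p : nat, `|1 + U / p%:R| <= 1}.
  move=> p pP; apply: norm_mean_factor.
  - by move: pP; rewrite mem_sift_primes => /andP[/prime_gt0].
  - have [] := rP p pP; rewrite ler_nat => rp _.
    by rewrite (leq_trans _ rp)// leq_pmull.
  - by move=> i; rewrite /u subrKC norm_cexp_im.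
have reUp (p : nat) : complex.Re (U * (p%:R^-1)%:C) <= 0.
  by case: (U) reU => a c /= a0; rewrite mulr0 subr0 mulr_le0_ge0// invr_ge0.
have pC (p : nat) : (p%:R^-1)%:C = p%:R^-1 :> R[i] by rewrite fmorphV rmorph_nat.
apply: le_trans (norm_prod_sub_le U1 _) _.
  by move=> p _; rewrite normC_cexp lecR expR_le1; exact: reUp.
rewrite mulrAC mulr_sumr rmorph_sum big_seq [leRHS]big_seq.
apply: ler_sum => p pP; have [rp yp] := rP p pP.
have p0 : 0 < p%:R :> R := lt_trans y0 yp.
have Up : `|U / p%:R| <= (2 * r)%:R / p%:R.
  by rewrite normrM normfV normr_nat ler_wpM2r// invr_ge0.
rewrite -pC distrC opprD addrA; apply: le_trans (cexp_sub1_le (reUp p) _) _.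
  rewrite pC; apply: le_trans Up _.
  by rewrite -(rmorph_nat (real_complex R)) -pC -rmorphM lecR ler_pdivrMr// mul1r.
rewrite pC; apply: (@le_trans _ _ (2 * ((2 * r)%:R / p%:R) ^+ 2)).
  by rewrite ler_wpM2l// lerXn2r ?nnegrE// divr_ge0.
rewrite -pC -!(rmorph_nat (real_complex R)) -rmorphM -rmorphXn -rmorphM lecR.
rewrite natrM expr2.
have : p%:R^-1 <= y^-1 by rewrite lef_pV2 ?posrE// ltW.
have : 0 <= p%:R^-1 :> R by rewrite invr_ge0.
have r0 : 0 <= r%:R :> R by [].
move: (p%:R^-1) => q q0 qy.
rewrite (_ : 2 * (2 * r%:R * q * (2 * r%:R * q)) = q * q * (8 * r%:R ^+ 2));
  last by ring.
by rewrite mulrC -mulrA ler_wpM2l ?mulr_ge0 ?sqr_ge0// mulrC ler_wpM2r.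
Qed.

(** The four errors come, in order, from truncating at level [K], from counting in residue classes
    with at most [z] primes, from replacing the integer part of [x] by [x], and from
    [prod_euler_cexp]. Here [V = 2r], since [|u i| <= 2]. *)
Lemma char_mean_bound (x : R) K (T : 'I_r -> R) :
  (forall i, t i = T i / Num.sqrt S) ->
  1 <= x -> 0 < y -> 0 <= z -> (2 * r)%:R <= y ->
  `| (x^-1)%:C * (\sum_(1 <= n < (Num.truncn x).+1) \prod_(i < r)
         cexp ('i%C * (T i)%:C *
               (((omega (n + b i) y z)%:R - S) / Num.sqrt S)%:C))
     - \prod_(i < r) cexp ((cexp ('i%C * (t i)%:C) - 1 - 'i%C * (t i)%:C) * S%:C) |
  <= (2 * ((2 * r%:R * S) ^+ K / K`!%:R) + (1 + 2 * r%:R * z) ^+ K / x + x^-1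
      + 8 * r%:R ^+ 2 * S / y)%:C.
Proof.
move=> tE x1 y0 z0 ry; have x0 : 0 < x := lt_le_trans ltr01 x1.
set U := \sum_i u i; pose N := Num.truncn x.
(* The phases [exp(-i t_i S)] do not depend on [n] and occur on both sides, so [c] factors out of
   the difference and has modulus 1. *)
pose c := \prod_(i < r) cexp (- ('i * (t i * S)%:C)) : R[i].
have c1 : `|c| = 1.
  rewrite normr_prod big1// => i _.
  by rewrite -mulrN -rmorphN norm_cexp_im.
have -> : \sum_(1 <= n < N.+1) \prod_(i < r) cexp ('i%C * (T i)%:C *
    (((omega (n + b i) y z)%:R - S) / Num.sqrt S)%:C) =
    (\sum_(1 <= n < N.+1) \prod_(p <- P) (1 + hit b u n p)) * c.
  rewrite mulr_suml big_seq [RHS]big_seq; apply: eq_bigr => n.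
  rewrite mem_index_iota => /andP[n0 _]; rewrite -prod_expn_omega// -big_split/=.
  apply: eq_bigr => i _; rewrite -cexpMn -cexpD; congr cexp.
  rewrite tE -[_ *+ _ in RHS]mulr_natr -(rmorph_nat (real_complex R)).
  have ringE (j a o s q : R[i]) :
      j * a * ((o - s) * q) = j * (a * q) * o - j * (a * q * s).
    by ring.
  by rewrite !rmorphM rmorphB /=; exact: ringE.
have -> : \prod_(i < r) cexp ((cexp ('i%C * (t i)%:C) - 1 - 'i%C * (t i)%:C) * S%:C)
    = cexp (U * S%:C) * c.
  rewrite mulr_suml cexp_sum -big_split/=; apply: eq_bigr => i _.
  by rewrite -cexpD mulrBl rmorphM mulrA.
rewrite [_ * (_ * c)]mulrA -[_ - _ * c]mulrBl normrM c1 mulr1.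
have rP p : p \in P -> (0 < p)%N && (r <= p)%N.
  rewrite mem_sift_primes => /and3P[pp yp _]; rewrite prime_gt0//=.
  have := ltW (le_lt_trans ry yp); rewrite ler_nat; apply: leq_trans.
  by rewrite leq_pmull.
have u1 i : `|1 + u i| <= 1 by rewrite /u subrKC norm_cexp_im.
have U2 : \sum_i `|u i| <= (2 * r%:R)%:C.
  apply: (@le_trans _ _ (\sum_(i < r) 2)).
    by apply: ler_sum => i _; exact: norm_charfactor.
  by rewrite sumr_const card_ord rmorphM !rmorph_nat -[leLHS]mulr_natr.
set M := \prod_(p <- P) (1 + U / p%:R).
have M1 : `|M| <= 1.
  rewrite normr_prod big_seq prodr_ile1// => p /rP/andP[p0 rp].
  by rewrite normr_ge0 norm_mean_factor.
have mean := @mean_multiplicative _ r b u P K N _ (sift_primes_uniq y z)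
  (sift_primes_prime y z) _ sift_primes_disjoint u1 U2.
have {}mean := mean _; rewrite -/U -/M in mean.
set A := \sum_(_ <= _ < _) _ in mean *.
have {}mean : `|A - N%:R * M| <=
    (2 * (x * ((2 * r%:R * S) ^+ K / K`!%:R)) + (1 + 2 * r%:R * z) ^+ K)%:C.
  apply: le_trans (mean _) _; first by apply/allP => p /rP/andP[].
  have -> : \sum_(p <- P) p%:R^-1 = S%:C :> R[i].
    rewrite prime_recip_sumE rmorph_sum; apply: eq_bigr => p _.
    by rewrite fmorphV rmorph_nat.
  have -> : N%:R * (((2 * r%:R)%:C * S%:C) ^+ K / K`!%:R) *+ 2
      + (1 + (2 * r%:R)%:C * (size P)%:R) ^+ K =
      (N%:R * ((2 * r%:R * S) ^+ K / K`!%:R) *+ 2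
      + (1 + 2 * r%:R * (size P)%:R) ^+ K)%:C :> R[i].
    by rewrite !(rmorphD, rmorphM, rmorphMn, rmorphXn, fmorphV, rmorph_nat, rmorph1).
  rewrite lecR.
  have S0 : 0 <= S := prime_recip_sum_ge0 y z.
  rewrite lerD//.
    rewrite -[leLHS]mulr_natl ler_wpM2l// ler_wpM2r ?truncn_le ?(ltW x0)//.
    by rewrite divr_ge0// exprn_ge0// !mulr_ge0.
  rewrite lerXn2r ?nnegrE ?addr_ge0 ?mulr_ge0//.
  by rewrite lerD2l ler_wpM2l ?mulr_ge0// size_sift_primes.
have -> : (x^-1)%:C * A - cexp (U * S%:C) = (x^-1)%:C * (A - N%:R * M)
    + ((x^-1)%:C * N%:R - 1) * M + (M - cexp (U * S%:C)) by ring.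
rewrite rmorphD; apply: le_trans (ler_normD _ _) _; apply: lerD;
  last exact: prod_euler_cexp.
rewrite rmorphD; apply: le_trans (ler_normD _ _) _; apply: lerD.
  rewrite normrM ger0_norm ?lecR ?invr_ge0 ?(ltW x0)//.
  apply: le_trans (ler_wpM2l _ mean) _; first by rewrite lecR invr_ge0 ltW.
  rewrite -rmorphM lecR mulrDr mulrCA mulKf ?gt_eqF// [_ / x]mulrC.
  exact: lexx.
rewrite normrM; apply: le_trans (ler_piMr _ M1) _; first exact: normr_ge0.
have /andP[N1 N2] := truncn_itv (ltW x0); rewrite -/N in N1 N2.
have -> : (x^-1)%:C * N%:R - 1 = - ((x - N%:R) / x)%:C.
  rewrite rmorphM rmorphB rmorph_nat mulrBl -rmorphM divff ?gt_eqF// rmorph1 opprB.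
  by rewrite mulrC.
rewrite normrN ger0_norm lecR ?divr_ge0 ?subr_ge0 ?(ltW x0)//.
by rewrite ler_pdivrMr// mulVf ?gt_eqF// lerBlDl natr1 ltW.
Qed.
End char_mean.

(** * Size of the errors for large [x], with [L = ln x] and [l = ln L] *)

Section asymptotics.
Variable R : realType.

Lemma expR1_le4 : expR 1 <= 4 :> R.
Proof.
have : 1 + - (1 / 2) <= expR (- (1 / 2)) :> R := expR_ge1Dx _.
have e0 : 0 < expR (1 / 2) :> R := expR_gt0 _.
rewrite expRN => /ler_wpM2l => /(_ _ (ltW e0)); rewrite divff ?gt_eqF// => h.
have -> : 1 = 1 / 2 + 1 / 2 :> R by lra.
by rewrite expRD; nra.
Qed.

Lemma expR_cube_le (l : R) : 0 <= l -> l ^+ 3 / 6 <= expR l.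
Proof.
move=> l0; apply: le_trans (expR_ge1Dxn 2 l0).
have -> : 3`!%:R = 6 :> R by [].
lra.
Qed.

Lemma exprn_div_fact_le (M : R) K : 0 <= M -> M ^+ K / K`!%:R <= expR M.
Proof.
move=> M0; case: K => [|K].
  by rewrite expr0 fact0 divr1; have := expR_ge1Dx M; lra.
by apply: le_trans (expR_ge1Dxn K M0); rewrite lerDr.
Qed.

(** A substitute for Stirling's formula: the left side is [4^(-K)] times a term of the series of
    [exp(4M)], and [4 >= e]. *)
Lemma exprn_div_fact_le_expRB (M : R) K : 0 <= M -> M ^+ K / K`!%:R <= expR (4 * M - K%:R).
Proof.
move=> M0; rewrite expRB.
have -> : M ^+ K / K`!%:R = (4 * M) ^+ K / K`!%:R / 4 ^+ K.
  by rewrite exprMn mulrAC [4 ^+ K * _]mulrC mulfK// expf_neq0.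
have eK : expR K%:R <= 4 ^+ K :> R.
  by rewrite -[K%:R]mulr1 expRM_natl lerXn2r ?nnegrE ?expR_ge0 ?expR1_le4.
apply: ler_pM.
- by rewrite divr_ge0// exprn_ge0// mulr_ge0.
- by rewrite invr_ge0 exprn_ge0.
- by apply: exprn_div_fact_le; rewrite mulr_ge0.
- by rewrite lef_pV2 ?posrE ?expR_gt0 ?exprn_gt0.
Qed.

Lemma prime_recip_sum_le (y z : R) n : z <= (2 ^ n.+1)%:R ->
  prime_recip_sum y z <= 3 + 2 * ln n.+1%:R.
Proof.
move=> zn; apply: le_trans (sum_prime_recip_le R n).
have tz : (Num.truncn z <= 2 ^ n.+1)%N.
  by rewrite truncn_le_nat (le_lt_trans zn)// ltr_nat.
rewrite /prime_recip_sum big_mkcond [leRHS]big_mkcond.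
rewrite [leRHS](@big_cat_nat _ _ _ (Num.truncn z).+1)//=.
rewrite -[leLHS]addr0 lerD//.
  by apply: ler_sum => p _; case: (prime p) => //=; case: ifP => // _; rewrite invr_ge0.
by apply: sumr_ge0 => p _; case: ifP => // _; rewrite invr_ge0.
Qed.

Variables (r : nat) (x : R).
Hypothesis r_gt0 : (0 < r)%N.
Let L := ln x.
Let l := ln L.
Hypothesis l_ge : 100 * r%:R + 100 <= l.
Hypothesis L_gt0 : 0 < L.
Hypothesis x_gt0 : 0 < x.

Let r1 : 1 <= r%:R :> R. Proof. by rewrite ler1n. Qed.
Let LE : expR l = L. Proof. by rewrite lnK// posrE. Qed.
Let xE : expR L = x. Proof. by rewrite lnK// posrE. Qed.
Let l_ge200 : 200 <= l. Proof. by have := r1; have := l_ge; lra. Qed.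

Lemma log_ge_cube : l ^+ 3 / 6 <= L.
Proof. by rewrite -LE expR_cube_le//; have := l_ge200; lra. Qed.

(** Twice the inequality [6 r l^2 + l <= L / 2] on which [sieve_error_small] rests. It holds because
    [l / 6] exceeds [12 r] by a wide margin. *)
Lemma log_ge_sqr : 12 * r%:R * l ^+ 2 + 2 * l <= L.
Proof.
apply: le_trans log_ge_cube; have := r1; have := l_ge; have := l_ge200.
have -> : l ^+ 3 / 6 = (l / 6) * l ^+ 2 by rewrite exprS; lra.
by rewrite expr2; nra.
Qed.

Lemma log_ge_loglog : l <= L.
Proof. by have := log_ge_sqr; have := r1; have := l_ge200; rewrite expr2; nra. Qed.

Let L1 : 1 <= L. Proof. by have := log_ge_loglog; have := l_ge200; lra. Qed.

Lemma ycut_ge : L ^+ 3 <= ycut r x.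
Proof. by rewrite /ycut -/L ler_weXn2l// -[3%N in leqLHS]muln1 leq_mul2l. Qed.

Lemma zcutE : zcut r x = expR (L / l ^+ (3 * r)).
Proof. by rewrite /zcut /powR gt_eqF// mulrC. Qed.

Lemma zcut_exponent_le : 0 <= L / l ^+ (3 * r) <= L / l ^+ 3.
Proof.
have l1 : 1 <= l by have := l_ge200; lra.
have l0 : 0 < l by lra.
rewrite divr_ge0 ?exprn_ge0 ?(ltW l0) ?(ltW L_gt0)//=.
rewrite ler_wpM2l ?(ltW L_gt0)// lef_pV2 ?posrE ?exprn_gt0//.
by rewrite ler_weXn2l// -[3%N in leqLHS]muln1 leq_mul2l.
Qed.

Lemma zcut_le : zcut r x <= x.
Proof.
rewrite zcutE -[leRHS]xE ler_expR; have /andP[_] := zcut_exponent_le.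
move/le_trans; apply; have l1 : 1 <= l by have := l_ge200; lra.
rewrite ler_pdivrMr ?exprn_gt0 ?(lt_le_trans ltr01 l1)//.
by rewrite ler_peMr ?(ltW L_gt0)// exprn_ege1.
Qed.

Lemma prime_recip_sum_le_loglog : prime_recip_sum (ycut r x) (zcut r x) <= 11 * l.
Proof.
have L2 : 0 <= 2 * L by rewrite mulr_ge0// ltW.
have /andP[n1 n2] := truncn_itv L2.
(* With [n] the integer part of [2L], [n + 1 > 2L] and [e^(1/2) <= 2] give [x = e^L <= 2^(n+1)]. The
   bound is then at most [3 + 2 ln 3 + 2 l]. *)
apply: le_trans (@prime_recip_sum_le _ _ (Num.truncn (2 * L)) _) _.
  apply: le_trans zcut_le _; rewrite -[leLHS]xE natrX.
  set n := (Num.truncn _).+1.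
  have e2 : expR (1 / 2) <= 2 :> R.
    have : expR (1 / 2 + 1 / 2) <= 4 :> R by rewrite (_ : _ + _ = 1) ?expR1_le4//; lra.
    by rewrite expRD; have := @expR_gt0 R (1 / 2); nra.
  apply: (@le_trans _ _ (expR (n%:R * (1 / 2)))).
    by rewrite ler_expR; rewrite -/n in n2; lra.
  by rewrite expRM_natl lerXn2r ?nnegrE ?expR_ge0.
have : ln (Num.truncn (2 * L)).+1%:R <= ln (3 * L).
  by rewrite ler_ln ?posrE ?mulr_gt0// -natr1; have := L1; lra.
have : ln 3 < 3 :> R by rewrite ln_sublinear.
rewrite lnM ?posrE// -/l.
by have := l_ge200; lra.
Qed.

(** Of order [l^2]: large enough for the factorial to beat [(2rS)^K] with [S = O(l)], small enough
    for [z^K] to be a small power of [x]. *)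
Definition trunc_level := (Num.truncn (l ^+ 2)).+1.

Lemma trunc_level_bounds : l ^+ 2 <= trunc_level%:R <= 2 * l ^+ 2.
Proof.
have l2 : 1 <= l ^+ 2 by rewrite exprn_ege1//; have := l_ge200; lra.
have /andP[h1 h2] := truncn_itv (le_trans ler01 l2).
by rewrite /trunc_level (ltW h2)/= -natr1; lra.
Qed.

Lemma tail_small : (2 * r%:R * prime_recip_sum (ycut r x) (zcut r x)) ^+ trunc_level
   / trunc_level`!%:R <= L^-1.
Proof.
have S0 := prime_recip_sum_ge0 (ycut r x) (zcut r x); have S11 := prime_recip_sum_le_loglog.
apply: le_trans (exprn_div_fact_le_expRB _ _) _; first by rewrite !mulr_ge0.
rewrite -LE -expRN ler_expR; have /andP[+ _] := trunc_level_bounds.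
set k := trunc_level%:R; set S := prime_recip_sum _ _ in S0 S11 *.
rewrite expr2; have : r%:R * S <= r%:R * (11 * l) by rewrite ler_wpM2l.
(* The exponent is at most [88 r l - l^2], which is at most [-l] because [l >= 88 r + 1]. *)
move: r1 l_ge l_ge200; nra.
Qed.

(** Since [K <= 2 l^2] and [ln z <= L / l^3], [z^K] is at most [exp(2L / l)], far below [x]. *)
Lemma sieve_error_small : (1 + 2 * r%:R * zcut r x) ^+ trunc_level / x <= L^-1.
Proof.
have /andP[w0 wle] := zcut_exponent_le; set w := L / _ in w0 wle.
have z1 : 1 <= zcut r x by rewrite zcutE -expR0 ler_expR.
have /andP[_ kle] := trunc_level_bounds.
(* As [z >= 1], the base satisfies [1 + 2rz <= 3rz <= e^(3r) z], and [z = e^w]. *)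
apply: (@le_trans _ _ (expR (trunc_level%:R * (3 * r%:R + w)) / x)).
  rewrite ler_wpM2r ?invr_ge0 ?(ltW x_gt0)// expRM_natl lerXn2r ?nnegrE ?expR_ge0//.
    by rewrite addr_ge0// !mulr_ge0// (le_trans ler01).
  rewrite expRD -zcutE; apply: (@le_trans _ _ (3 * r%:R * zcut r x)).
    by have := r1; nra.
  by rewrite ler_wpM2r ?(le_trans ler01 z1)//; have := expR_ge1Dx (3 * r%:R : R); lra.
rewrite -[x in _ / x]xE -expRB -[in leRHS]LE -expRN ler_expR.
have kw : trunc_level%:R * w <= 2 * L / l.
  apply: (@le_trans _ _ (2 * l ^+ 2 * (L / l ^+ 3))).
    by apply: ler_pM.
  by rewrite le_eqVlt; apply/orP; left; apply/eqP; field; have := l_ge200; lra.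
have : 2 * L / l <= L / 2.
  rewrite ler_pdivrMr; last by have := l_ge200; lra.
  have := ler_wpM2l (ltW L_gt0) l_ge200; have := L_gt0; lra.
have := log_ge_sqr; have := r1.
have : trunc_level%:R * (3 * r%:R) <= 2 * l ^+ 2 * (3 * r%:R).
  by rewrite ler_wpM2r// mulr_ge0.
rewrite mulrDr; lra.
Qed.

Lemma S_div_y_small : prime_recip_sum (ycut r x) (zcut r x) / ycut r x <= 11 / L.
Proof.
have S0 := prime_recip_sum_ge0 (ycut r x) (zcut r x).
have L3 : 0 < L ^+ 3 by rewrite exprn_gt0.
apply: (@le_trans _ _ (11 * l / L ^+ 3)).
  apply: ler_pM; rewrite ?prime_recip_sum_le_loglog//.
    by rewrite invr_ge0 (le_trans (ltW L3) ycut_ge).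
  by rewrite lef_pV2 ?posrE// ?ycut_ge// (lt_le_trans L3 ycut_ge).
rewrite ler_pdivrMr// exprS mulrA mulfVK ?gt_eqF//.
by rewrite ler_wpM2l//; have := log_ge_loglog; have := L1; nra.
Qed.
End asymptotics.

(** * Choice of constants and assembly of the estimates *)

Theorem theorem4 (R : realType) (delta lambda : R) (r : nat)
    (delta_gt0 : 0 < delta) (delta_lt : delta < 1 / 2)
    (lambda_gt0 : 0 < lambda) (r_gt0 : (0 < r)%N) :
  exists C x0 : R, forall x : R, x0 <= x ->
    let y := ycut r x in
    let z := zcut r x in
    let S := prime_recip_sum y z in
    forall b : 'I_r -> nat,
      (forall i j : 'I_r, (i < j)%N -> (b i < b j)%N) ->
      (forall i : 'I_r, (b i)%:R <= lambda * ln (ln x) `^ (1 / 2 - delta)) ->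
    forall T : 'I_r -> R,
    let t := fun i : 'I_r => T i / Num.sqrt S in
      (forall i : 'I_r, `|T i| <= 1 / 1000 * Num.sqrt S) ->
    `| (x^-1)%:C * (\sum_(1 <= n < (Num.truncn x).+1) \prod_(i < r)
           cexp ('i%C * (T i)%:C *
                 (((omega (n + b i) y z)%:R - S) / Num.sqrt S)%:C))
       - \prod_(i < r) cexp ((cexp ('i%C * (t i)%:C) - 1 - 'i%C * (t i)%:C) * S%:C) |
      <= (C / ln x)%:C.
Proof.
have error_sum (A B v s q i : R) : A <= i -> B <= i -> v <= i ->
    8 * q * s <= 8 * q * (11 * i) ->
    2 * A + B + v + 8 * q * s <= 4 * i + 88 * q * i by lra.
(* The first two terms serve the asymptotic section; [lambda] is added so that [lambda <= l], which
   keeps the shifts below [y]. *)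
pose l0 := 100 * r%:R + 100 + lambda : R.
(* In units of [1 / ln x]: 2 for the doubled tail, 1 for the counting error, 1 for [x^-1], and
   [8 r^2 * 11] for the Euler product. *)
exists (4 + 88 * r%:R ^+ 2), (expR (expR l0)) => x x0x y z S b b_inc b_le T t _.
have x_gt0 : 0 < x := lt_le_trans (expR_gt0 _) x0x.
have L_ge : expR l0 <= ln x by rewrite -ler_expR lnK ?posrE.
have L_gt0 : 0 < ln x := lt_le_trans (expR_gt0 _) L_ge.
have l_ge0 : l0 <= ln (ln x) by rewrite -ler_expR lnK ?posrE.
have r1 : 1 <= r%:R :> R by rewrite ler1n.
have l_ge : 100 * r%:R + 100 <= ln (ln x).
  by apply: le_trans l_ge0; rewrite lerDl ltW.
have Ll := log_ge_sqr r_gt0 l_ge L_gt0.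
have L1 : 1 <= ln x.
  by have := log_ge_loglog r_gt0 l_ge L_gt0; lra.
have Ly : ln x <= y.
  by apply: le_trans (ycut_ge r_gt0 l_ge L_gt0); rewrite ler_eXnr.
have x1 : 1 <= x by rewrite -(lnK (x := x)) ?posrE// -expR0 ler_expR ltW.
(* The exponent [1/2 - delta] is at most 1 and [l >= 1], so the shift is at most
   [lambda l <= l^2 < L <= y]. *)
have b_lt i : (b i)%:R < y.
  apply: le_lt_trans (b_le i) _; apply: lt_le_trans Ly.
  apply: (@le_lt_trans _ _ (lambda * ln (ln x))).
    rewrite ler_wpM2l ?(ltW lambda_gt0)// ler1_powR//; first by lra.
    by lra.
  apply: lt_le_trans Ll; rewrite /l0 in l_ge0; rewrite expr2; nra.
have ry : (2 * r)%:R <= y.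
  by apply: le_trans Ly; apply: le_trans Ll; rewrite natrM expr2; nra.
have y_gt0 : 0 < y := lt_le_trans L_gt0 Ly.
have z_ge0 : 0 <= z := powR_ge0 _ _.
apply: le_trans (char_mean_bound b_inc b_lt (trunc_level x) (fun=> erefl)
  x1 y_gt0 z_ge0 ry) _.
rewrite lecR [leRHS]mulrDl.
have h1 := tail_small r_gt0 l_ge L_gt0 x_gt0.
have h2 := sieve_error_small r_gt0 l_ge L_gt0 x_gt0.
have h3 := S_div_y_small r_gt0 l_ge L_gt0 x_gt0.
have h4 : x^-1 <= (ln x)^-1 by rewrite lef_pV2 ?posrE// ltW// ln_sublinear.
rewrite -/y -/z -/S in h1 h2 h3.
rewrite -[_ * S / y]mulrA; apply: error_sum => //.
by rewrite ler_wpM2l// mulr_ge0// sqr_ge0.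
Qed.
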